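(* Let $k$ be a field, let $\mathcal{T}$ be a Hom-finite Krull-Schmidt triangulated $k$-category, let $\mathcal{J}$ be an ideal of $\mathcal{T}$ such that $\mathcal{A}=\mathcal{T}/\mathcal{J}$ is abelian, and let $\pi:\mathcal{T}\to\mathcal{A}$ be the quotient functor, assumed cohomological. Suppose $\mathcal{A}$ has a basic projective generator $P$, and let $T$ be the minimal preimage of $P$ in $\mathcal{T}$. Then $\pi$ is naturally isomorphic to $\operatorname{Hom}_{\mathcal{T}}(T,-)$, where $\mathcal{A}$ is identified with $\operatorname{mod}\Gamma$, $\Gamma=\operatorname{End}_{\mathcal{T}}(T)^{\mathrm{op}}$, as described in the context; that is, the functors $\operatorname{Hom}_{\mathcal{A}}(P,\pi(-))$ and $\operatorname{Hom}_{\mathcal{T}}(T,-)$ from $\mathcal{T}$ to $\operatorname{mod}\Gamma$ are naturally isomorphic.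
   Context: $\mathcal{T}/\mathcal{J}$ has the same objects as $\mathcal{T}$ and morphisms $\operatorname{Hom}_{\mathcal{T}}(X,Y)/\mathcal{J}(X,Y)$. A projective object $P$ of $\mathcal{A}$ is a projective generator if for every object $X$ of $\mathcal{A}$ there is an epimorphism $P^n\twoheadrightarrow X$ for some $n\in\mathbb{N}$. Basic means that the indecomposable summands are pairwise non-isomorphic. The minimal preimage of $P$ is the basic object $T\in\mathcal{T}$ such that $\pi(T)=P$ and $\pi(T')\neq0$ for all indecomposable summands $T'$ of $T$. Let $\Lambda=\operatorname{End}_{\mathcal{A}}(P)^{\mathrm{op}}$. The functor $\operatorname{Hom}_{\mathcal{A}}(P,-)$ is an equivalence $\mathcal{A}\cong\operatorname{mod}\Lambda$ (finitely generated left modules), and $\pi$ induces an isomorphism of $k$-algebras $\Gamma\cong\Lambda$; together these identify $\mathcal{A}$ with $\operatorname{mod}\Gamma$. *)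

(* Defs.v *)
From HB Require Import structures.
From mathcomp Require Import all_boot all_order all_algebra.
From mathcomp Require Import boolp.

Set Implicit Arguments.
Unset Strict Implicit.
Unset Printing Implicit Defensive.

Import GRing.Theory.
Local Open Scope ring_scope.
Local Open Scope quotient_scope.

Declare Scope cat_scope.
Local Open Scope cat_scope.

Record category := Category {
  obj :> Type;
  hom : obj -> obj -> Type;
  idm : forall X, hom X X;
  comp : forall X Y Z, hom Y Z -> hom X Y -> hom X Z;
  compA : forall W X Y Z (h : hom Y Z) (g : hom X Y) (f : hom W X),
    comp h (comp g f) = comp (comp h g) f;
  comp1m : forall X Y (f : hom X Y), comp (idm Y) f = f;
  compm1 : forall X Y (f : hom X Y), comp f (idm X) = f }.

Arguments hom {c} X Y.
Arguments idm {c} X.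
Arguments comp {c X Y Z} g f.

Notation "g '\oc' f" := (comp g f) (at level 40, left associativity) : cat_scope.

Record iso (C : category) (X Y : C) := Iso {
  fwd : hom X Y;
  bwd : hom Y X;
  bwdK : bwd \oc fwd = idm X;
  fwdK : fwd \oc bwd = idm Y }.

Definition is_iso (C : category) (X Y : C) (f : hom X Y) : Prop :=
  exists g : hom Y X, g \oc f = idm X /\ f \oc g = idm Y.

Definition isomorphic (C : category) (X Y : C) : Prop :=
  exists f : hom X Y, is_iso f.

Definition monic (C : category) (X Y : C) (f : hom X Y) : Prop :=
  forall W (g h : hom W X), f \oc g = f \oc h -> g = h.

Definition epic (C : category) (X Y : C) (f : hom X Y) : Prop :=
  forall Z (g h : hom Y Z), g \oc f = h \oc f -> g = h.

Definition projective (C : category) (P : C) : Prop :=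
  forall (X Y : C) (e : hom X Y) (f : hom P Y), epic e ->
  exists g : hom P X, e \oc g = f.

Record functor (C D : category) := Functor {
  fob :> C -> D;
  fmor : forall X Y : C, hom X Y -> hom (fob X) (fob Y);
  fmor1 : forall X : C, fmor (idm X) = idm (fob X);
  fmorM : forall (X Y Z : C) (g : hom Y Z) (f : hom X Y),
    fmor (g \oc f) = fmor g \oc fmor f }.

Arguments fmor {C D} F {X Y} f : rename.

Lemma fcomp_proof1 (C D E : category) (G : functor D E) (F : functor C D)
  (X : C) : fmor G (fmor F (idm X)) = idm (G (F X)).
Proof. by rewrite !fmor1. Qed.

Lemma fcomp_proofM (C D E : category) (G : functor D E) (F : functor C D)
  (X Y Z : C) (g : hom Y Z) (f : hom X Y) :
  fmor G (fmor F (g \oc f)) = fmor G (fmor F g) \oc fmor G (fmor F f).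
Proof. by rewrite !fmorM. Qed.

Definition fcomp (C D E : category) (G : functor D E) (F : functor C D) :
  functor C E :=
  @Functor C E (fun X => G (F X)) (fun X Y f => fmor G (fmor F f))
    (fcomp_proof1 G F) (@fcomp_proofM C D E G F).

Notation "G '\of' F" := (fcomp G F) (at level 40, left associativity) : cat_scope.

Definition nat_iso (C D : category) (F G : functor C D) : Prop :=
  exists eta : forall X : C, hom (F X) (G X),
    (forall (X Y : C) (f : hom X Y), eta Y \oc fmor F f = fmor G f \oc eta X)
    /\ (forall X : C, is_iso (eta X)).

Definition idf (C : category) : functor C C :=
  @Functor C C (fun X => X) (fun X Y f => f) (fun X => erefl)
    (fun X Y Z g f => erefl).

Definition equivalence (C D : category) (F : functor C D) : Prop :=
  exists G : functor D C, nat_iso (G \of F) (idf C) /\ nat_iso (F \of G) (idf D).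

(* A category with a k-vector space structure on each hom-set; the bilinearity
   of composition is imposed in [lincat]. *)
Record hom_mod (k : fieldType) := HomMod {
  hcat :> category;
  hclass : forall X Y : hcat, GRing.Lmodule k (hom X Y) }.

HB.instance Definition _ (k : fieldType) (C : hom_mod k) (X Y : C) :
  GRing.Lmodule k (hom X Y) := hclass X Y.

Record lincat (k : fieldType) := LinCat {
  lbase :> hom_mod k;
  comp_linear : forall (X Y Z : lbase) (g : hom Y Z),
    linear (fun f : hom X Y => g \oc f);
  comp_linearl : forall (X Y Z : lbase) (f : hom X Y),
    linear (fun g : hom Y Z => g \oc f) }.

Section LinearCategories.
Context {k : fieldType}.

Lemma comp0m (C : lincat k) (X Y Z : C) (f : hom X Y) : (0 : hom Y Z) \oc f = 0.
Proof.
have h := comp_linearl f (-1) (0 : hom Y Z) 0.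
by move: h => /=; rewrite scaler0 addr0 scaleN1r addNr.
Qed.

Lemma compm0 (C : lincat k) (X Y Z : C) (g : hom Y Z) : g \oc (0 : hom X Y) = 0.
Proof. by have /= := comp_linear g (-1) (0 : hom X Y) 0; rewrite scaler0 addr0 scaleN1r addNr. Qed.

Lemma compDm (C : lincat k) (X Y Z : C) (g h : hom Y Z) (f : hom X Y) :
  (g + h) \oc f = g \oc f + h \oc f.
Proof. by have /= := comp_linearl f 1 g h; rewrite !scale1r. Qed.

Lemma compmD (C : lincat k) (X Y Z : C) (h : hom Y Z) (f g : hom X Y) :
  h \oc (f + g) = h \oc f + h \oc g.
Proof. by have /= := comp_linear h 1 f g; rewrite !scale1r. Qed.

Lemma compZm (C : lincat k) (X Y Z : C) a (g : hom Y Z) (f : hom X Y) :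
  (a *: g) \oc f = a *: (g \oc f).
Proof. by have /= := comp_linearl f a g (0 : hom Y Z); rewrite comp0m !addr0. Qed.

Lemma compmZ (C : lincat k) (X Y Z : C) a (g : hom Y Z) (f : hom X Y) :
  g \oc (a *: f) = a *: (g \oc f).
Proof. by have /= := comp_linear g a f (0 : hom X Y); rewrite compm0 !addr0. Qed.

Lemma compBm (C : lincat k) (X Y Z : C) (g h : hom Y Z) (f : hom X Y) :
  (g - h) \oc f = g \oc f - h \oc f.
Proof. by rewrite compDm -scaleN1r compZm scaleN1r. Qed.

Lemma compmB (C : lincat k) (X Y Z : C) (h : hom Y Z) (f g : hom X Y) :
  h \oc (f - g) = h \oc f - h \oc g.
Proof. by rewrite compmD -scaleN1r compmZ scaleN1r. Qed.

Definition linear_functor (C D : lincat k) (F : functor C D) : Prop :=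
  forall X Y : C, linear (fun f : hom X Y => fmor F f).

Definition is_zero (C : lincat k) (X : C) : Prop :=
  forall Y : C, (forall f : hom X Y, f = 0) /\ (forall f : hom Y X, f = 0).

(* [S] is a direct sum (biproduct) of the finite family [F]; the empty family
   has the zero objects as direct sums. *)
Definition is_dsum (C : lincat k) (n : nat) (F : 'I_n -> C) (S : C) : Prop :=
  exists (inj : forall i, hom (F i) S) (prj : forall i, hom S (F i)),
    [/\ forall i, prj i \oc inj i = idm (F i),
        forall i j, i != j -> prj j \oc inj i = 0
      & \sum_(i < n) (inj i \oc prj i) = idm S].

Definition is_dsum2 (C : lincat k) (X Y S : C) : Prop :=
  exists (i1 : hom X S) (i2 : hom Y S) (p1 : hom S X) (p2 : hom S Y),
    [/\ p1 \oc i1 = idm X, p2 \oc i2 = idm Y, p2 \oc i1 = 0, p1 \oc i2 = 0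
      & i1 \oc p1 + i2 \oc p2 = idm S].

Definition additive_cat (C : lincat k) : Prop :=
  forall (n : nat) (F : 'I_n -> C), exists S : C, is_dsum F S.

Definition is_kernel (C : lincat k) (X Y K : C) (f : hom X Y) (i : hom K X) :
  Prop :=
  f \oc i = 0 /\
  forall (W : C) (g : hom W X), f \oc g = 0 -> exists! h : hom W K, i \oc h = g.

Definition is_cokernel (C : lincat k) (X Y Q : C) (f : hom X Y) (p : hom Y Q) :
  Prop :=
  p \oc f = 0 /\
  forall (W : C) (g : hom Y W), g \oc f = 0 -> exists! h : hom Q W, h \oc p = g.

Definition abelian_cat (C : lincat k) : Prop :=
  additive_cat C /\
  [/\ forall (X Y : C) (f : hom X Y), exists (K : C) (i : hom K X), is_kernel f i,
      forall (X Y : C) (f : hom X Y), exists (Q : C) (p : hom Y Q), is_cokernel f p,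
      forall (X Y : C) (f : hom X Y), monic f ->
        exists (Z : C) (g : hom Y Z), is_kernel g f
    & forall (X Y : C) (f : hom X Y), epic f ->
        exists (W : C) (g : hom W X), is_cokernel g f].

(* The image of [f], i.e. the kernel of its cokernel, is the kernel of [g]. *)
Definition exact_at (C : lincat k) (X Y Z : C) (f : hom X Y) (g : hom Y Z) : Prop :=
  exists (Q : C) (p : hom Y Q) (I : C) (i : hom I Y),
    [/\ is_cokernel f p, is_kernel p i & is_kernel g i].

Definition indecomposable (C : lincat k) (X : C) : Prop :=
  ~ is_zero X /\
  forall Y Z : C, is_dsum2 Y Z X -> is_zero Y \/ is_zero Z.

Definition is_summand (C : lincat k) (Y X : C) : Prop :=
  exists Z : C, is_dsum2 Y Z X.

(* In a Krull-Schmidt category a decomposition into indecomposables exists and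
   is unique up to isomorphism and order, so any one of them may be tested. *)
Definition basic (C : lincat k) (X : C) : Prop :=
  forall (n : nat) (F : 'I_n -> C), is_dsum F X ->
  (forall i, indecomposable (F i)) ->
  forall i j, i != j -> ~ isomorphic (F i) (F j).

Definition projective_generator (C : lincat k) (P : C) : Prop :=
  projective P /\
  forall X : C, exists (n : nat) (S : C) (e : hom S X),
    is_dsum (fun _ : 'I_n => P) S /\ epic e.

(* The endomorphism ring is local: it is nonzero and a sum of two non-units is a
   non-unit. *)
Definition local_endo (C : lincat k) (X : C) : Prop :=
  idm X <> 0 /\
  forall f g : hom X X, is_iso (f + g) -> is_iso f \/ is_iso g.

Definition krull_schmidt (C : lincat k) : Prop :=
  additive_cat C /\
  forall X : C, exists (n : nat) (F : 'I_n -> C),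
    is_dsum F X /\ forall i, local_endo (F i).

End LinearCategories.

Definition fin_gen (R : pzRingType) (M : lmodType R) : Prop :=
  exists (n : nat) (e : 'I_n -> M),
    forall v : M, exists c : 'I_n -> R, v = \sum_(i < n) c i *: e i.

Definition hom_finite (k : fieldType) (C : lincat k) : Prop :=
  forall X Y : C, fin_gen (hom X Y).

Definition shifted_triangle (C : category) (S : functor C C) : Type :=
  forall X Y Z : C, hom X Y -> hom Y Z -> hom Z (S X) -> Prop.

Record triangulated (k : fieldType) := Triangulated {
  tcat :> lincat k;
  shift : functor tcat tcat;
  dist : shifted_triangle shift;
  tr_additive : additive_cat tcat;
  shift_linear : linear_functor shift;
  shift_equiv : equivalence shift;
  tr_iso : forall (X Y Z X' Y' Z' : tcat)
      (u : hom X Y) (v : hom Y Z) (w : hom Z (shift X))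
      (u' : hom X' Y') (v' : hom Y' Z') (w' : hom Z' (shift X'))
      (a : hom X X') (b : hom Y Y') (c : hom Z Z'),
    is_iso a -> is_iso b -> is_iso c ->
    b \oc u = u' \oc a -> c \oc v = v' \oc b -> fmor shift a \oc w = w' \oc c ->
    dist u v w -> dist u' v' w';
  tr_id : forall X Z : tcat, is_zero Z ->
    dist (idm X) (0 : hom X Z) (0 : hom Z (shift X));
  tr_cone : forall (X Y : tcat) (u : hom X Y),
    exists (Z : tcat) (v : hom Y Z) (w : hom Z (shift X)), dist u v w;
  tr_rot : forall (X Y Z : tcat) (u : hom X Y) (v : hom Y Z) (w : hom Z (shift X)),
    dist u v w <-> dist v w (- fmor shift u);
  tr_fill : forall (X Y Z X' Y' Z' : tcat)
      (u : hom X Y) (v : hom Y Z) (w : hom Z (shift X))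
      (u' : hom X' Y') (v' : hom Y' Z') (w' : hom Z' (shift X'))
      (a : hom X X') (b : hom Y Y'),
    dist u v w -> dist u' v' w' -> b \oc u = u' \oc a ->
    exists c : hom Z Z', c \oc v = v' \oc b /\ fmor shift a \oc w = w' \oc c;
  tr_oct : forall (X Y Z X' Y' Z' : tcat)
      (u : hom X Y) (j : hom Y Z') (d : hom Z' (shift X))
      (v : hom Y Z) (l : hom Z X') (i : hom X' (shift Y))
      (m : hom Z Y') (n : hom Y' (shift X)),
    dist u j d -> dist v l i -> dist (v \oc u) m n ->
    exists (f : hom Z' Y') (g : hom Y' X'),
      [/\ dist f g (fmor shift j \oc i),
          f \oc j = m \oc v, n \oc f = d, g \oc m = l
        & i \oc g = fmor shift u \oc n] }.

Arguments dist {k} t {X Y Z} _ _ _.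

Definition cohomological (k : fieldType) (T : triangulated k) (A : lincat k)
  (H : functor T A) : Prop :=
  linear_functor H /\
  forall (X Y Z : T) (u : hom X Y) (v : hom Y Z) (w : hom Z (shift T X)),
    dist T u v w -> exact_at (fmor H u) (fmor H v).

Record ideal (k : fieldType) (C : lincat k) := Ideal {
  imem :> forall X Y : C, hom X Y -> Prop;
  imem0 : forall X Y : C, imem (0 : hom X Y);
  imemB : forall (X Y : C) (f g : hom X Y), imem f -> imem g -> imem (f - g);
  imem_l : forall (X Y Z : C) (g : hom Y Z) (f : hom X Y),
    imem f -> imem (g \oc f);
  imem_r : forall (X Y Z : C) (g : hom Y Z) (f : hom X Y),
    imem g -> imem (g \oc f) }.

Arguments imem {k C} J {X Y} f : rename.

Section QuotientCategory.
Context {k : fieldType} {C : lincat k} (J : ideal C).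

Definition imem_pred (X Y : C) : {pred hom X Y} := fun f => `[< J _ _ f >].

Lemma imem_predP (X Y : C) (f : hom X Y) :
  reflect (J _ _ f) (f \in @imem_pred X Y).
Proof. exact: asboolP. Qed.

Lemma imem_zmod_closed (X Y : C) : zmod_closed (@imem_pred X Y).
Proof.
split; first by apply/imem_predP; exact: imem0.
move=> f g /imem_predP Jf /imem_predP Jg; apply/imem_predP; exact: imemB.
Qed.

HB.instance Definition _ (X Y : C) :=
  GRing.isZmodClosed.Build (hom X Y) (@imem_pred X Y) (@imem_zmod_closed X Y).

Lemma imemZ (X Y : C) (a : k) (f : hom X Y) : J _ _ f -> J _ _ (a *: f).
Proof.
by move=> Jf; rewrite -[f]comp1m -compZm; apply: imem_l.
Qed.

Definition qhom (X Y : C) : Type := Quotient.quot (@imem_pred X Y).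

HB.instance Definition _ (X Y : C) := GRing.Zmodule.on (qhom X Y).

Definition qpi (X Y : C) (f : hom X Y) : qhom X Y := \pi_(Quotient.quot _) f.
Definition qrepr (X Y : C) (q : qhom X Y) : hom X Y :=
  repr (q : Quotient.quot (@imem_pred X Y)).

Lemma qreprK (X Y : C) (q : qhom X Y) : qpi (qrepr q) = q.
Proof. exact: reprK. Qed.

Lemma qpi_eqP (X Y : C) (f g : hom X Y) : qpi f = qpi g <-> J _ _ (f - g).
Proof.
split; first by move=> /eqP; rewrite -Quotient.idealrBE => /imem_predP.
by move=> Jfg; apply/eqP; rewrite -Quotient.idealrBE; apply/imem_predP.
Qed.

Lemma qpi_zmod_morphism (X Y : C) : zmod_morphism (@qpi X Y).
Proof. by move=> f g; rewrite /qpi !piE. Qed.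

Lemma imem_repr (X Y : C) (f : hom X Y) : J _ _ (qrepr (qpi f) - f).
Proof. by apply/qpi_eqP; rewrite qreprK. Qed.

Lemma qpiD (X Y : C) (f g : hom X Y) : qpi (f + g) = qpi f + qpi g.
Proof. by rewrite /qpi !piE. Qed.

Definition qscale (X Y : C) (a : k) (q : qhom X Y) : qhom X Y :=
  qpi (a *: qrepr q).

Lemma qscale_pi (X Y : C) (a : k) (f : hom X Y) :
  qscale a (qpi f) = qpi (a *: f).
Proof. by apply/qpi_eqP; rewrite -scalerBr; apply/imemZ/imem_repr. Qed.

Lemma qscaleA (X Y : C) a b (q : qhom X Y) :
  qscale a (qscale b q) = qscale (a * b) q.
Proof. by rewrite -[q]qreprK !qscale_pi scalerA. Qed.

Lemma qscale1 (X Y : C) : left_id 1 (@qscale X Y).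
Proof. by move=> q; rewrite -[q]qreprK qscale_pi scale1r. Qed.

Lemma qscaleDr (X Y : C) : right_distributive (@qscale X Y) +%R.
Proof.
move=> a q r; rewrite -[q]qreprK -[r]qreprK -qpiD !qscale_pi -qpiD.
by rewrite scalerDr.
Qed.

Lemma qscaleDl (X Y : C) (q : qhom X Y) :
  {morph (@qscale X Y)^~ q : a b / a + b}.
Proof. by move=> a b; rewrite -[q]qreprK !qscale_pi -qpiD scalerDl. Qed.

HB.instance Definition _ (X Y : C) :=
  GRing.Zmodule_isLmodule.Build k (qhom X Y)
    (@qscaleA X Y) (@qscale1 X Y) (@qscaleDr X Y) (@qscaleDl X Y).

Definition qcomp (X Y Z : C) (g : qhom Y Z) (f : qhom X Y) : qhom X Z :=
  qpi (qrepr g \oc qrepr f).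

Lemma qcomp_pi (X Y Z : C) (g : hom Y Z) (f : hom X Y) :
  qcomp (qpi g) (qpi f) = qpi (g \oc f).
Proof.
apply/qpi_eqP; set g' := qrepr _; set f' := qrepr _.
have -> : g' \oc f' - g \oc f = (g' - g) \oc f' - g \oc (f - f').
  by rewrite compBm compmB opprB addrA addrNK.
apply: imemB; first by apply/imem_r/imem_repr.
by apply: imem_l; apply/qpi_eqP; rewrite qreprK.
Qed.

Lemma qcompA (W X Y Z : C) (h : qhom Y Z) (g : qhom X Y) (f : qhom W X) :
  qcomp h (qcomp g f) = qcomp (qcomp h g) f.
Proof.
by rewrite -[h]qreprK -[g]qreprK -[f]qreprK !qcomp_pi compA.
Qed.

Lemma qcomp1m (X Y : C) (f : qhom X Y) : qcomp (qpi (idm Y)) f = f.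
Proof. by rewrite -[f]qreprK qcomp_pi comp1m. Qed.

Lemma qcompm1 (X Y : C) (f : qhom X Y) : qcomp f (qpi (idm X)) = f.
Proof. by rewrite -[f]qreprK qcomp_pi compm1. Qed.

Definition quotient_cat : category :=
  Category qcompA qcomp1m qcompm1.

Definition quotient_hom_mod : hom_mod k :=
  @HomMod k quotient_cat (fun X Y => GRing.Lmodule.on (qhom X Y)).

Lemma qcomp_linear (X Y Z : quotient_hom_mod) (g : hom Y Z) :
  linear (fun f : hom X Y => g \oc f).
Proof.
move=> a f f'; change (qcomp g (qscale a f + f') = qscale a (qcomp g f) + qcomp g f').
rewrite -[f]qreprK -[f']qreprK -[g]qreprK qscale_pi -qpiD !qcomp_pi qscale_pi.
by rewrite -qpiD compmD compmZ.
Qed.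

Lemma qcomp_linearl (X Y Z : quotient_hom_mod) (f : hom X Y) :
  linear (fun g : hom Y Z => g \oc f).
Proof.
move=> a g g'; change (qcomp (qscale a g + g') f = qscale a (qcomp g f) + qcomp g' f).
rewrite -[f]qreprK -[g]qreprK -[g']qreprK qscale_pi -qpiD !qcomp_pi qscale_pi.
by rewrite -qpiD compDm compZm.
Qed.

Definition quotient : lincat k := LinCat qcomp_linear qcomp_linearl.

Lemma qfunctorM (X Y Z : C) (g : hom Y Z) (f : hom X Y) :
  qpi (g \oc f) = qcomp (qpi g) (qpi f).
Proof. by rewrite qcomp_pi. Qed.

Definition qfunctor : functor C quotient :=
  @Functor C quotient (fun X => X) qpi (fun X => erefl) qfunctorM.

Lemma qfunctor_full (X Y : C) (q : hom (qfunctor X) (qfunctor Y)) :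
  exists f : hom X Y, fmor qfunctor f = q.
Proof. by exists (qrepr q); exact: qreprK. Qed.

Lemma qfunctor_linear : linear_functor qfunctor.
Proof.
move=> X Y a f g; change (qpi (a *: f + g) = qscale a (qpi f) + qpi g).
by rewrite qscale_pi qpiD.
Qed.

Lemma qfunctor0 (X Y : C) : fmor qfunctor (0 : hom X Y) = 0.
Proof.
have /= := @qfunctor_linear X Y (-1) (0 : hom X Y) 0.
by rewrite scaler0 addr0 scaleN1r addNr.
Qed.

Lemma qfunctorD (X Y : C) (f g : hom X Y) :
  fmor qfunctor (f + g) = fmor qfunctor f + fmor qfunctor g.
Proof. by have /= := qfunctor_linear 1 f g; rewrite !scale1r. Qed.

Lemma qfunctorZ (X Y : C) (a : k) (f : hom X Y) :
  fmor qfunctor (a *: f) = a *: fmor qfunctor f.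
Proof. by have := qfunctor_linear a f (0 : hom X Y); rewrite /= addr0 [X in _ + X]qfunctor0 addr0. Qed.

Lemma quotient_hom_finite : hom_finite C -> hom_finite quotient.
Proof.
move=> fC X Y; have [n [e he]] := fC X Y.
exists n, (fun i => fmor qfunctor (e i)) => q.
have [f <-] := @qfunctor_full X Y q; have [c ->] := he f; exists c.
rewrite (big_morph (fmor qfunctor) (@qfunctorD X Y) (@qfunctor0 X Y)).
by apply: eq_bigr => i _; rewrite qfunctorZ.
Qed.

End QuotientCategory.

(* The ring of endomorphisms of [X], with composition as product; it is the
   zero ring when [X] is a zero object. *)
Definition endo (k : fieldType) (C : lincat k) (X : C) : Type := hom X X.

Section Endo.
Context {k : fieldType} {C : lincat k} (X : C).

HB.instance Definition _ := GRing.Zmodule.copy (endo X) (hom X X).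

Definition endo_mul (g f : endo X) : endo X := g \oc f.

Lemma endo_mulA : associative endo_mul.
Proof. by move=> h g f; exact: compA. Qed.
Lemma endo_mul1 : left_id (idm X : endo X) endo_mul.
Proof. by move=> f; exact: comp1m. Qed.
Lemma endo_mulr1 : right_id (idm X : endo X) endo_mul.
Proof. by move=> f; exact: compm1. Qed.
Lemma endo_mulDl : left_distributive endo_mul +%R.
Proof. by move=> g h f; exact: compDm. Qed.
Lemma endo_mulDr : right_distributive endo_mul +%R.
Proof. by move=> h f g; exact: compmD. Qed.

HB.instance Definition _ := GRing.Zmodule_isPzRing.Build (endo X)
  endo_mulA endo_mul1 endo_mulr1 endo_mulDl endo_mulDr.

End Endo.

(* Hom(P, X), a left module over the opposite of End(P) by precomposition. *)
Definition hom_from (k : fieldType) (C : lincat k) (P X : C) : Type := hom P X.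

Section HomFrom.
Context {k : fieldType} {C : lincat k} (P X : C).

HB.instance Definition _ := GRing.Zmodule.copy (hom_from P X) (hom P X).

Definition hom_from_scale (a : ((endo P)^c)%type) (f : hom_from P X) :
  hom_from P X := f \oc (a : endo P).

Lemma hom_from_scaleA a b f :
  hom_from_scale a (hom_from_scale b f) = hom_from_scale (a * b) f.
Proof. by rewrite /hom_from_scale -compA. Qed.
Lemma hom_from_scale1 : left_id 1 hom_from_scale.
Proof. by move=> f; exact: compm1. Qed.
Lemma hom_from_scaleDr : right_distributive hom_from_scale +%R.
Proof. by move=> a f g; exact: compDm. Qed.
Lemma hom_from_scaleDl f : {morph hom_from_scale^~ f : a b / a + b}.
Proof. by move=> a b; exact: compmD. Qed.

HB.instance Definition _ := GRing.Zmodule_isLmodule.Build (endo P)^c (hom_from P X)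
  hom_from_scaleA hom_from_scale1 hom_from_scaleDr hom_from_scaleDl.

Lemma hom_from_fin_gen : hom_finite C -> fin_gen (hom_from P X).
Proof.
move=> fC; have [n [e he]] := fC P X; exists n, e => f; have [c ->] := he f.
exists (fun i => c i *: idm P); apply: eq_bigr => i _.
by rewrite -[e i in LHS]compm1 -compmZ.
Qed.

End HomFrom.

Lemma linear_ext (R : pzRingType) (U V : lmodType R) (f g : {linear U -> V}) :
  f =1 g -> f = g.
Proof.
case: f g => [f [[af] [lf]]] [g [[ag] [lg]]] /= /funext fg.
case: _ / fg in ag lg *.
by rewrite (Prop_irrelevance ag af) (Prop_irrelevance lg lf).
Qed.

Record fg_module (R : pzRingType) := FgModule {
  fg_sort :> lmodType R;
  fg_sortP : fin_gen fg_sort }.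

Section ModuleCategory.
Context (R : pzRingType).

Definition mod_hom (M N : fg_module R) : Type := {linear M -> N}.
Definition mod_id (M : fg_module R) : mod_hom M M := idfun.
Definition mod_comp (L M N : fg_module R) (g : mod_hom M N) (f : mod_hom L M) :
  mod_hom L N := g \o f.

Lemma mod_compA (K L M N : fg_module R)
  (h : mod_hom M N) (g : mod_hom L M) (f : mod_hom K L) :
  mod_comp h (mod_comp g f) = mod_comp (mod_comp h g) f.
Proof. exact: linear_ext. Qed.
Lemma mod_comp1m (M N : fg_module R) (f : mod_hom M N) :
  mod_comp (mod_id N) f = f.
Proof. exact: linear_ext. Qed.
Lemma mod_compm1 (M N : fg_module R) (f : mod_hom M N) :
  mod_comp f (mod_id M) = f.
Proof. exact: linear_ext. Qed.

Definition modc : category := Category mod_compA mod_comp1m mod_compm1.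

End ModuleCategory.

(* The functor Hom(P, -) to finitely generated left modules over the opposite
   of End(P); Hom-finiteness provides the finite generation. *)
Section HomFunctor.
Context {k : fieldType} {C : lincat k} (fC : hom_finite C) (P : C).

Definition homf_obj (X : C) : modc (endo P)^c :=
  @FgModule _ (hom_from P X) (hom_from_fin_gen P X fC).

Definition post (X Y : C) (f : hom X Y) (u : hom_from P X) : hom_from P Y :=
  f \oc u.

Lemma post_linear (X Y : C) (f : hom X Y) : linear (post f).
Proof. by move=> a u v; rewrite /post compmD; congr (_ + _); exact: compA. Qed.

HB.instance Definition _ (X Y : C) (f : hom X Y) :=
  GRing.isLinear.Build (endo P)^c (hom_from P X) (hom_from P Y) *:%R (post f)
    (post_linear f).

Definition homf_mor (X Y : C) (f : hom X Y) : hom (homf_obj X) (homf_obj Y) :=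
  (post f : {linear hom_from P X -> hom_from P Y}).

Lemma homf_mor1 (X : C) : homf_mor (idm X) = idm (homf_obj X).
Proof. by apply: linear_ext => u; exact: comp1m. Qed.
Lemma homf_morM (X Y Z : C) (g : hom Y Z) (f : hom X Y) :
  homf_mor (g \oc f) = homf_mor g \oc homf_mor f.
Proof. by apply: linear_ext => u; apply/esym/compA. Qed.

Definition homf : functor C (modc (endo P)^c) := Functor homf_mor1 homf_morM.

End HomFunctor.

Definition restr (R S : pzRingType) (th : {rmorphism R -> S}) (M : lmodType S) :
  Type := M.

Section Restriction.
Context {R S : pzRingType} (th : {rmorphism R -> S}).

Section Module.
Context (M : lmodType S).

HB.instance Definition _ := GRing.Zmodule.copy (restr th M) M.

Definition restr_scale (a : R) (x : restr th M) : restr th M :=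
  th a *: (x : M).

Lemma restr_scaleA a b x : restr_scale a (restr_scale b x) = restr_scale (a * b) x.
Proof. by rewrite /restr_scale scalerA rmorphM. Qed.
Lemma restr_scale1 : left_id 1 restr_scale.
Proof. by move=> x; rewrite /restr_scale rmorph1 scale1r. Qed.
Lemma restr_scaleDr : right_distributive restr_scale +%R.
Proof. by move=> a x y; exact: scalerDr. Qed.
Lemma restr_scaleDl x : {morph restr_scale^~ x : a b / a + b}.
Proof. by move=> a b; rewrite /restr_scale rmorphD scalerDl. Qed.

HB.instance Definition _ := GRing.Zmodule_isLmodule.Build R (restr th M)
  restr_scaleA restr_scale1 restr_scaleDr restr_scaleDl.

Lemma restr_fin_gen : (forall b, exists a, th a = b) -> fin_gen M ->
  fin_gen (restr th M).
Proof.
move=> surj [n [e he]]; exists n, e => x; have [c ->] := he x.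
have [d hd] := choice (fun i => surj (c i)).
by exists d; apply: eq_bigr => i _; rewrite -hd.
Qed.

End Module.

Definition restr_map (M N : lmodType S) (f : {linear M -> N}) :
  restr th M -> restr th N := f.

Lemma restr_map_linear (M N : lmodType S) (f : {linear M -> N}) :
  linear (restr_map f).
Proof. by move=> a x y; exact: linearP. Qed.

HB.instance Definition _ (M N : lmodType S) (f : {linear M -> N}) :=
  GRing.isLinear.Build R (restr th M) (restr th N) *:%R (restr_map f)
    (restr_map_linear f).

Context (surj : forall b, exists a, th a = b).

Definition restr_obj (M : modc S) : modc R :=
  @FgModule R (restr th M) (restr_fin_gen surj (fg_sortP M)).

Definition restr_mor (M N : modc S) (f : hom M N) :
  hom (restr_obj M) (restr_obj N) :=
  (restr_map f : {linear restr th M -> restr th N}).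

Lemma restr_mor1 (M : modc S) : restr_mor (idm M) = idm (restr_obj M).
Proof. exact: linear_ext. Qed.
Lemma restr_morM (L M N : modc S) (g : hom M N) (f : hom L M) :
  restr_mor (g \oc f) = restr_mor g \oc restr_mor f.
Proof. exact: linear_ext. Qed.

Definition restriction : functor (modc S) (modc R) := Functor restr_mor1 restr_morM.

End Restriction.

(* The identification of module categories uses the ring morphism End_C(T)^op -> End_{C/J}(P)^op
   sending g to phi pi(g) phi^-1, and is restriction of scalars along it. Since
   T is determined only up to isomorphism, pi(T) = P is read as an isomorphism
   phi. Surjectivity is what keeps restricted modules finitely generated. *)
Section InducedMorphism.
Context {k : fieldType} {C : lincat k} (J : ideal C) (T : C) (P : quotient J)
  (phi : iso (qfunctor J T) P).

Definition induced (g : ((endo T)^c)%type) : ((endo P)^c)%type :=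
  (fwd phi \oc fmor (qfunctor J) (g : hom T T) \oc bwd phi : endo P).

Lemma induced_zmod_morphism : zmod_morphism induced.
Proof.
move=> f g; rewrite /induced.
have -> : fmor (qfunctor J) (f - g : hom T T)
        = fmor (qfunctor J) (f : hom T T) - fmor (qfunctor J) (g : hom T T).
  exact: qpi_zmod_morphism.
by rewrite compmB compBm.
Qed.

Lemma induced_monoid_morphism : monoid_morphism induced.
Proof.
split=> [|f g]; first by rewrite /induced fmor1 compm1 fwdK.
rewrite /induced.
have -> : fmor (qfunctor J) (f * g : hom T T)
        = fmor (qfunctor J) (g : hom T T) \oc fmor (qfunctor J) (f : hom T T).
  exact: fmorM.
have h : forall (x y : hom (qfunctor J T) (qfunctor J T)),
   fwd phi \oc (y \oc x) \oc bwd phi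
   = (fwd phi \oc y \oc bwd phi) \oc (fwd phi \oc x \oc bwd phi).
  move=> x y; rewrite -!compA; congr (_ \oc (_ \oc _)).
  by rewrite !compA bwdK comp1m.
exact: h.
Qed.

HB.instance Definition _ := GRing.isZmodMorphism.Build (endo T)^c (endo P)^c
  induced induced_zmod_morphism.
HB.instance Definition _ := GRing.isMonoidMorphism.Build (endo T)^c (endo P)^c
  induced induced_monoid_morphism.

Lemma induced_surj (b : ((endo P)^c)%type) : exists a, induced a = b.
Proof.
have [a ha] := qfunctor_full (bwd phi \oc (b : hom P P) \oc fwd phi).
exists a; rewrite /induced ha !compA fwdK comp1m.
by rewrite -compA fwdK compm1.
Qed.

Definition transport : functor (modc (endo P)^c) (modc (endo T)^c) :=
  @restriction _ _ induced induced_surj.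

End InducedMorphism.

Definition minimal_preimage (k : fieldType) (C : lincat k) (J : ideal C)
  (P : quotient J) (T : C) : Prop :=
  [/\ isomorphic (qfunctor J T) P, basic T
    & forall T' : C, indecomposable T' -> is_summand T' T ->
        ~ is_zero (qfunctor J T')].

(* Main.v *)
Require Import Defs.
From HB Require Import structures.
From mathcomp Require Import all_boot all_algebra.
(* [vector] has its own [hom]; here [hom] is to mean the morphisms of a category. *)
Import Defs.

(** The point is that J(T0, X) = 0 for every X
    ([ideal_minimal_preimage0]): then the full functor pi is also faithful on
    morphisms out of T0, so Hom(T0, X) -> Hom(pi T0, pi X) is a bijection, and
    composing with the isomorphism phi : pi T0 -> P turns it into a bijection
    with Hom(P, pi X), natural in X and compatible with the two actions of
    End(T0) because the action on Hom(P, pi X) is defined by conjugating pi with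
    phi.

    To see that J(T0, X) = 0, decompose T0 into summands with local endomorphism
    rings; it suffices to kill every f : T' -> X in J out of one such summand T'
    ([ideal_local_projective0]).  Complete f to a triangle W -g-> T' -f-> X
    ([cocone]).  Since pi is cohomological and pi f = 0, pi g is epic
    ([exact_at0_epic]); as a retract of pi T0 = P, the object pi T' is
    projective, so pi g has a section, which lifts to s : T' -> W by fullness of
    pi.  Thus 1 - g s lies in J.  By locality either g s or 1 - g s is
    invertible.  The second would put an isomorphism in J and force pi T' = 0,
    which minimality of T0 forbids.  Hence g s is invertible, and f g = 0 gives
    f = 0. *)

Set Implicit Arguments.
Unset Strict Implicit.
Unset Printing Implicit Defensive.

Import GRing.Theory.
Local Open Scope ring_scope.
Local Open Scope cat_scope.

(** * Direct sums, local objects and exactness *)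

Section LinearCategory.
Context {k : fieldType} (C : lincat k).

Lemma comp_suml (n : nat) (X Y Z : C) (g : 'I_n -> hom Y Z) (f : hom X Y) :
  (\sum_i g i) \oc f = \sum_i (g i \oc f).
Proof.
apply: (big_morph (fun h => h \oc f)) => [a b|]; [exact: compDm|exact: comp0m].
Qed.

Lemma comp_sumr (n : nat) (X Y Z : C) (g : hom Y Z) (f : 'I_n -> hom X Y) :
  g \oc (\sum_i f i) = \sum_i (g \oc f i).
Proof.
apply: (big_morph (fun h => g \oc h)) => [a b|]; [exact: compmD|exact: compm0].
Qed.

Lemma idm0_is_zero (X : C) : idm X = 0 -> is_zero X.
Proof.
move=> X0 Y; split=> f; first by rewrite -[f]compm1 X0 compm0.
by rewrite -[f]comp1m X0 comp0m.
Qed.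

Lemma zero_object : additive_cat C -> exists Z : C, is_zero Z.
Proof.
move=> addC.
have [Z [inj [prj [_ _ Z1]]]] := addC 0 (fun i => False_rect C (notF (ltn_ord i))).
by exists Z; apply: idm0_is_zero; rewrite -Z1 big_ord0.
Qed.

Lemma eq0_of_comp_iso (X Y Z : C) (f : hom Y Z) (g : hom X Y) (s : hom Y X) :
  f \oc g = 0 -> is_iso (g \oc s) -> f = 0.
Proof.
move=> fg0 [t [_ gst]].
by rewrite -[f]compm1 -gst -compA compA fg0 comp0m.
Qed.

(** In a decomposition 1 = i1 p1 + i2 p2 one of the two idempotents is
    invertible by locality; it is orthogonal to the other, so the other summand
    vanishes. *)
Lemma local_endo_indecomposable (X : C) : local_endo X -> indecomposable X.
Proof.
move=> [X1 locX]; split=> [X0 | Y Z [i1 [i2 [p1 [p2 [pi1 pi2 p2i1 p1i2 i1i2]]]]]].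
  by apply: X1; have [f0 _] := X0 X; exact: f0.
have /locX[|] : is_iso (i1 \oc p1 + i2 \oc p2).
  by rewrite i1i2; exists (idm X); rewrite !comp1m.
- move/(eq0_of_comp_iso p2i1) => p20.
  by right; apply: idm0_is_zero; rewrite -pi2 p20 comp0m.
- move/(eq0_of_comp_iso p1i2) => p10.
  by left; apply: idm0_is_zero; rewrite -pi1 p10 comp0m.
Qed.

(** The complement of the i-th term is a direct sum of all the other terms. *)
Lemma dsum_is_summand (n : nat) (F : 'I_n -> C) (S : C) (i : 'I_n) :
  additive_cat C -> is_dsum F S -> is_summand (F i) S.
Proof.
case: n F i => [|n] F i addC; first by case: i.
move=> [inj [prj [pK p0 sum1]]].
have [Z [injZ [prjZ [pZK pZ0 sumZ]]]] := addC n (fun j => F (lift i j)).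
exists Z, (inj i), (\sum_j (inj (lift i j) \oc prjZ j)).
exists (prj i), (\sum_j (injZ j \oc prj (lift i j))).
have neq_lift_inj j l : j != l -> lift i j != lift i l.
  by apply: contra => /eqP/lift_inj->.
split=> //.
- rewrite comp_suml -sumZ; apply: eq_bigr => j _.
  rewrite comp_sumr (bigD1 j) //= big1 ?addr0 => [|l ne_lj].
    by rewrite -compA (compA (prj _)) pK comp1m.
  by rewrite -compA (compA (prj _)) p0 ?neq_lift_inj // comp0m compm0.
- rewrite comp_suml big1 // => j _.
  by rewrite -compA p0 ?compm0 // neq_lift.
- rewrite comp_sumr big1 // => j _.
  by rewrite compA p0 ?comp0m // eq_sym neq_lift.
- rewrite -sum1 (bigD1_ord i) //=; congr (_ + _).
  rewrite comp_suml; apply: eq_bigr => j _.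
  rewrite comp_sumr (bigD1 j) //= big1 ?addr0 => [|l ne_lj].
    by rewrite -compA (compA (prjZ _)) pZK comp1m.
  by rewrite -compA (compA (prjZ _)) pZ0 // comp0m compm0.
Qed.

(** The kernel of the zero map is everything, so exactness says that the
    cokernel of g kills the identity of Y, that is, g has zero cokernel. *)
Lemma exact_at0_epic (X Y Z : C) (g : hom X Y) (f : hom Y Z) :
  f = 0 -> exact_at g f -> epic g.
Proof.
move=> -> [Q [p [I [i [[pg0 cokp] [pi0 _] [_ keri]]]]]].
have [h [ih _]] := keri Y (idm Y) (comp0m _ _).
(* [h] is a section of the kernel [i], through which [p] is then forced to be 0. *)
have p0 : p = 0 by rewrite -[p]compm1 -ih compA pi0 comp0m.
move=> W u v uv; apply/eqP; rewrite -subr_eq0.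
have [|t [<- _]] := cokp W (u - v); first by rewrite compBm uv subrr.
by rewrite p0 compm0.
Qed.

End LinearCategory.

Lemma projective_retract (C : category) (P Q : C) (i : hom Q P) (p : hom P Q) :
  p \oc i = idm Q -> projective P -> projective Q.
Proof.
move=> pi1 projP X Y e f epi_e; have [g eg] := projP X Y e (f \oc p) epi_e.
by exists (g \oc i); rewrite compA eg -compA pi1 compm1.
Qed.

(** * Equivalences and triangles *)

Lemma faithful_of_nat_iso_id (C D : category) (F : functor C D)
    (G : functor D C) (X Y : C) (f g : hom X Y) :
  nat_iso (G \of F) (idf C) -> fmor F f = fmor F g -> f = g.
Proof.
move=> [eta [nat iso]] Ffg; have [t [_ et]] := iso X.
have : f \oc eta X = g \oc eta X.
  by have /= <- := nat _ _ f; have /= <- := nat _ _ g; rewrite Ffg.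
by move=> /(congr1 (fun h => h \oc t)); rewrite -!compA et !compm1.
Qed.

(** With G a quasi-inverse of F, the preimage of h is G h conjugated by the
    isomorphism GF = 1.  It is correct after applying G, by naturality, hence
    before, since G is faithful too. *)
Lemma equivalence_full (C D : category) (F : functor C D) (X Y : C)
    (h : hom (F X) (F Y)) :
  equivalence F -> exists f : hom X Y, fmor F f = h.
Proof.
move=> [G [GF FG]]; have [al [nat iso]] := GF.
have /= [s [sal _]] := iso X; have /= [t [tal _]] := iso Y.
exists (al Y \oc fmor G h \oc s); apply: (faithful_of_nat_iso_id FG).
have /= natf := nat _ _ (al Y \oc fmor G h \oc s).
rewrite -[LHS]comp1m -tal -compA natf -!compA sal compm1.
by rewrite compA tal comp1m.
Qed.

Section Triangulated.
Context {k : fieldType} (T : triangulated k).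

(** The triangle on the identity of X maps to the given one by (1, u); the
    induced map on third terms starts from 0, so v u factors through 0. *)
Lemma dist_comp0 (X Y Z : T) (u : hom X Y) (v : hom Y Z) (w : hom Z (shift T X)) :
  dist T u v w -> v \oc u = 0.
Proof.
move=> duvw; have [O O0] := zero_object (@tr_additive _ T).
have [|c [<- _]] := tr_fill (a := idm X) (b := u) (tr_id X O0) duvw; first by [].
by rewrite compm0.
Qed.

(** A cone f, v, w of f has third map w : Z -> S X.  Fullness and essential
    surjectivity of the shift S desuspend w to a map into X; rotating backwards
    changes its sign. *)
Lemma cocone (X Y : T) (f : hom X Y) :
  exists (W : T) (g : hom W X) (h : hom Y (shift T W)), dist T g f h.
Proof.
have [Z [v [w dfvw]]] := tr_cone f.
have [G [_ [ep [_ iso]]]] := shift_equiv T.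
have /= [t [tep ept]] := iso Z.
have [g Sg] := @equivalence_full _ _ (shift T) (G Z) X (w \oc ep Z) (shift_equiv T).
exists (G Z), (- g), (t \oc v); apply/tr_rot.
have -> : - fmor (shift T) (- g) = w \oc ep Z.
  have S0 : fmor (shift T) 0 = 0 :> hom (shift T (G Z)) (shift T X).
    have := shift_linear (-1) (0 : hom (G Z) X) 0.
    by rewrite scaler0 addr0 scaleN1r addNr.
  have := shift_linear (-1) g 0.
  by rewrite S0 !addr0 !scaleN1r => ->; rewrite opprK.
have id_iso (V : T) : is_iso (idm V) by exists (idm V); rewrite comp1m.
have t_iso : is_iso t by exists (ep Z).
apply: tr_iso (id_iso X) (id_iso Y) t_iso _ _ _ dfvw.
- by rewrite comp1m compm1.
- by rewrite compm1.
- by rewrite fmor1 comp1m -compA ept compm1.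
Qed.

End Triangulated.

(** * Vanishing of the ideal on the minimal preimage *)

Section Quotient.
Context {k : fieldType} (T : triangulated k) (J : ideal T).

Lemma qfunctor_eq0 (X Y : T) (f : hom X Y) :
  fmor (qfunctor J) f = 0 <-> imem J f.
Proof. by rewrite -(qfunctor0 J X Y) -{2}[f]subr0; exact: qpi_eqP. Qed.

Lemma imem_iso_is_zero (X Y : T) (f : hom X Y) :
  imem J f -> is_iso f -> is_zero (qfunctor J X).
Proof.
move=> Jf [g [gf _]]; apply: idm0_is_zero.
by rewrite -fmor1 -gf; apply/qfunctor_eq0/imem_l.
Qed.

(** Locality of End(X) plays the part of the inclusion of J(X, X) in the radical:
    g s is congruent to 1 modulo J, so one of g s and 1 - g s is invertible, and
    the second cannot be. *)
Lemma ideal_local_projective0 (X Y : T) (f : hom X Y) :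
  cohomological (qfunctor J) -> local_endo X ->
  projective (qfunctor J X) -> ~ is_zero (qfunctor J X) ->
  imem J f -> f = 0.
Proof.
move=> [_ exJ] [_ locX] projX X0 Jf; have [W [g [h dgfh]]] := cocone f.
have epi_g : epic (fmor (qfunctor J) g).
  by apply: exact_at0_epic (exJ _ _ _ _ _ _ dgfh); apply/qfunctor_eq0.
have [s' gs'] := projX _ _ _ (idm _) epi_g.
have [s ss'] := qfunctor_full s'; rewrite -ss' in gs'.
have /locX[|] : is_iso (g \oc s + (idm X - g \oc s)).
  by rewrite addrC addrNK; exists (idm X); rewrite comp1m.
- exact: eq0_of_comp_iso (dist_comp0 dgfh).
- move/imem_iso_is_zero => Jid; case: X0; apply: Jid.
  apply/qpi_eqP; move: gs' => /= gs'; rewrite qfunctorM; exact: esym gs'.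
Qed.

(** Each local summand of T0 satisfies the hypotheses of
    [ideal_local_projective0]: its image under pi is a retract of P, hence
    projective, and it is nonzero by minimality of T0. *)
Lemma ideal_minimal_preimage0 (P : quotient J) (T0 X : T) (f : hom T0 X) :
  krull_schmidt T -> cohomological (qfunctor J) -> projective P ->
  minimal_preimage P T0 -> imem J f -> f = 0.
Proof.
move=> [addT KS] cohJ projP [[phi [psi [psiphi _]]] _ minT0] Jf.
have projT0 := projective_retract psiphi projP.
have [n [F [dsF locF]]] := KS T0; have [inj [prj [pK _ sum1]]] := dsF.
rewrite -[f]compm1 -sum1 comp_sumr big1 // => i _.
rewrite compA (_ : f \oc inj i = 0) ?comp0m //.
apply: ideal_local_projective0 cohJ (locF i) _ _ (imem_r (inj i) Jf).
- apply: (@projective_retract _ (qfunctor J T0) _ (fmor (qfunctor J) (inj i))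
    (fmor (qfunctor J) (prj i))) projT0.
  by rewrite -fmorM pK fmor1.
- apply: minT0; first exact: local_endo_indecomposable.
  exact: dsum_is_summand.
Qed.

End Quotient.

(** * The natural isomorphism *)

Lemma mod_bij_iso (R : pzRingType) (M N : modc R) (f : {linear M -> N})
    (g : N -> M) :
  cancel f g -> cancel g f -> is_iso (f : hom M N).
Proof.
move=> fK gK.
have g_lin : linear g.
  by move=> a x y; apply: (can_inj fK); rewrite linearP !gK.
pose gL : {linear N -> M} :=
  HB.pack g (GRing.isLinear.Build R N M *:%R g g_lin).
by exists gL; split; apply: linear_ext => x; [exact: fK|exact: gK].
Qed.

Section Lift.
Context {k : fieldType} (C : lincat k) (hfin : hom_finite C) (J : ideal C).
Context (P : quotient J) (T0 : C) (phi : iso (qfunctor J T0) P).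
Context (J0 : forall (X : C) (f : hom T0 X), imem J f -> f = 0).

Lemma qpi_inj (X : C) : injective (fmor (qfunctor J) : hom T0 X -> _).
Proof.
by move=> f g /qpi_eqP/J0/eqP; rewrite subr_eq0 => /eqP.
Qed.

(** The unique lift along pi of q phi : pi T0 -> pi X.  A chosen representative
    serves as the definition; linearity and naturality follow from uniqueness,
    [qpi_inj]. *)
Definition lift_hom (X : C) (q : restr (induced phi) (hom_from P (qfunctor J X))) :
  hom_from T0 X := qrepr ((q : hom P (qfunctor J X)) \oc fwd phi).

Lemma fmor_lift_hom (X : C) (q : hom P (qfunctor J X)) :
  fmor (qfunctor J) (lift_hom q : hom T0 X) = q \oc fwd phi.
Proof. exact: qreprK. Qed.

Lemma lift_hom_linear (X : C) : linear (@lift_hom X).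
Proof.
move=> a q r; apply: qpi_inj.
rewrite [RHS]qfunctorD [X in _ = X + _]fmorM !fmor_lift_hom compDm.
congr (_ + _).
(* An endomorphism a of T0 acts on q by precomposing with phi (pi a) phi^-1. *)
change ((q : hom P (qfunctor J X))
    \oc (fwd phi \oc fmor (qfunctor J) (a : hom T0 T0) \oc bwd phi) \oc fwd phi
  = (q : hom P (qfunctor J X)) \oc fwd phi \oc fmor (qfunctor J) (a : hom T0 T0)).
by rewrite -!compA bwdK compm1.
Qed.

Lemma lift_homK (X : C) :
  cancel (@lift_hom X) (fun f => fmor (qfunctor J) (f : hom T0 X) \oc bwd phi).
Proof. by move=> q; rewrite fmor_lift_hom -compA fwdK compm1. Qed.

Lemma lift_hom_bwdK (X : C) :
  cancel (fun f => fmor (qfunctor J) (f : hom T0 X) \oc bwd phi) (@lift_hom X).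
Proof. by move=> f; apply: qpi_inj; rewrite fmor_lift_hom -compA bwdK compm1. Qed.

HB.instance Definition _ (X : C) :=
  GRing.isLinear.Build (endo T0)^c (restr (induced phi) (hom_from P (qfunctor J X)))
    (hom_from T0 X) *:%R (@lift_hom X) (@lift_hom_linear X).

Lemma transport_homf_nat_iso :
  nat_iso (transport phi \of (homf (quotient_hom_finite hfin) P \of qfunctor J))
          (homf hfin T0).
Proof.
exists (fun X => (@lift_hom X : {linear _ -> _})); split=> [X Y f|X].
- apply: linear_ext => q; apply: qpi_inj.
  change (fmor (qfunctor J)
      (lift_hom (fmor (qfunctor J) f \oc (q : hom P (qfunctor J X))) : hom T0 Y)
    = fmor (qfunctor J) (f \oc (lift_hom q : hom T0 X))).
  by rewrite fmorM !fmor_lift_hom compA.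
- exact: (@mod_bij_iso _
    (fob (transport phi \of (homf (quotient_hom_finite hfin) P \of qfunctor J)) X)
    (homf hfin T0 X) (@lift_hom X) _ (@lift_homK X) (@lift_hom_bwdK X)).
Qed.

End Lift.

Theorem theorem14 (k : fieldType) (T : triangulated k)
  (hfin : hom_finite T) (KS : krull_schmidt T)
  (J : ideal T) (abA : abelian_cat (quotient J)) (cohpi : cohomological (qfunctor J))
  (P : quotient J) (genP : projective_generator P) (basP : basic P)
  (T0 : T) (minT0 : minimal_preimage P T0) (phi : iso (qfunctor J T0) P) :
  nat_iso (transport phi \of (homf (quotient_hom_finite hfin) P \of qfunctor J))
          (homf hfin T0).
Proof.
apply: transport_homf_nat_iso => X f.
by case: genP => projP _; exact: ideal_minimal_preimage0 KS cohpi projP minT0.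
Qed.
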